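(* For every integer $d \ge 2$, we have $\mathrm{ex}\bigl([n]^d; (d+1)_{\mathrm{pl}}, (d+2)_{\mathrm{sph}}\bigr) \ge \frac{n}{d+1} - o(n)$ as $n \to \infty$ (with $d$ fixed). Here $\mathrm{ex}\bigl([n]^d; (d+1)_{\mathrm{pl}}, (d+2)_{\mathrm{sph}}\bigr)$ is the maximum size of a subset of the grid $[n]^d$ that contains no $d+1$ distinct points lying on a common plane and no $d+2$ distinct points lying on a common sphere.
   Context: $[n] = \{1, 2, \dots, n\}$, and $[n]^d \subset \mathbb{R}^d$ is the $d$-dimensional integer grid. In $\mathbb{R}^d$, a ''plane'' means a $(d-1)$-dimensional affine hyperplane and a ''sphere'' means a $(d-1)$-dimensional Euclidean sphere. Points are coplanar (resp. cospherical) if they all lie on one plane (resp. one sphere). For $p, s$, $\mathrm{ex}([n]^d; p_{\mathrm{pl}}, s_{\mathrm{sph}})$ denotes the maximum size of a subset of $[n]^d$ containing neither $p$ coplanar points nor $s$ cospherical points. The notation $o(n)$ denotes a quantity whose ratio to $n$ tends to $0$ as $n \to \infty$ with $d$ fixed. *)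

(* Defs.v *)
(* MathComp / MathComp-Analysis; the reals are an arbitrary R : realType. *)
From mathcomp Require Import all_boot all_order all_algebra.
From mathcomp Require Import all_classical all_reals all_analysis.
Import Order.TTheory GRing.Theory Num.Theory.
Import numFieldNormedType.Exports.

Set Implicit Arguments.
Unset Strict Implicit.
Unset Printing Implicit Defensive.

Local Open Scope classical_set_scope.
Local Open Scope ring_scope.

Definition hyperplane (R : realType) (d : nat) (a : 'rV[R]_d) (b : R) :
  set 'rV[R]_d := [set x | \sum_(i < d) a 0 i * x 0 i = b].

(* The norm that the library puts on 'rV[R]_d is the sup norm, hence this
   explicit Euclidean distance. *)
Definition eucl_dist (R : realType) (d : nat) (x y : 'rV[R]_d) : R :=
  Num.sqrt (\sum_(i < d) (x 0 i - y 0 i) ^+ 2).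

Definition esphere (R : realType) (d : nat) (c : 'rV[R]_d) (r : R) :
  set 'rV[R]_d := [set x | eucl_dist x c = r].

Definition coplanar (R : realType) (d : nat) (S : set 'rV[R]_d) : Prop :=
  exists (a : 'rV[R]_d) (b : R), a != 0 /\ S `<=` hyperplane a b.

Definition cospherical (R : realType) (d : nat) (S : set 'rV[R]_d) : Prop :=
  exists (c : 'rV[R]_d) (r : R), 0 < r /\ S `<=` esphere c r.

(* 'rV['I_n]_d indexes the grid [n]^d; as 'I_n is {0, ..., n-1}, coordinates
   are shifted by one to land in {1, ..., n}. *)
Definition grid_pt (R : realType) (d n : nat) (x : 'rV['I_n]_d) : 'rV[R]_d :=
  \row_(i < d) (x 0 i).+1%:R.

Definition grid_pts (R : realType) (d n : nat) (B : {set 'rV['I_n]_d}) :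
  set 'rV[R]_d := [set grid_pt R x | x in [set` B]].
Arguments grid_pts R {d n} B.

Definition no_coplanar (R : realType) (d n p : nat)
    (A : {set 'rV['I_n]_d}) : Prop :=
  forall B : {set 'rV['I_n]_d},
    B \subset A -> #|B| = p -> ~ coplanar (grid_pts R B).

Definition no_cospherical (R : realType) (d n s : nat)
    (A : {set 'rV['I_n]_d}) : Prop :=
  forall B : {set 'rV['I_n]_d},
    B \subset A -> #|B| = s -> ~ cospherical (grid_pts R B).

(* ex([n]^d; p_pl, s_sph). The maximum over an empty family is 0, but for
   p, s > 0 the empty set always qualifies. *)
Definition ex_pl_sph (R : realType) (d n p s : nat) : nat :=
  \max_(A : {set 'rV['I_n]_d} |
        `[< no_coplanar R p A /\ no_cospherical R s A >]) #|A|.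

(* Main.v *)
(* Let p > 3 be prime. On a curve c over F_p whose coordinates, together with 1,
   span the polynomials of degree at most d (up to a common factor t^-k), a
   plane meets c in at most d points, and if moreover the quadratic form
   |c(t)|^2 only has the extreme terms t^(d+1-k) and t^(-k-1) outside that
   span, then d+2 cospherical parameters satisfy one equation on their product.
   Such a curve is obtained by pairing the monomials into isotropic vectors,
   which exist because -1 is a sum of two squares. For d = 2 mod 4 the form has
   a two-dimensional anisotropic part when p = 3 mod 4; one then makes the
   equation say that the product is a nonsquare, and keeps only the (p-1)/2
   parameters that are nonzero squares.

   Real coplanarity and cosphericity of integer points are the vanishing of
   integer determinants, so they reduce mod p. Averaging over translations of
   the curve gives at least ((p-1)/2) (min(n,p)/p)^d points in [n]^d, and the
   loss of a factor about 2 is affordable since only n/(d+1) is needed: a prime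
   in (m, 2m] with m = n/2, or m = 2n/3 if d = 2, suffices. *)
Require Import Defs.
From mathcomp Require Import all_boot all_order all_algebra.
From mathcomp Require Import fingroup cyclic.
From mathcomp Require Import zify ring.
From mathcomp Require Import all_classical all_reals all_analysis.
Import Order.TTheory GRing.Theory Num.Theory.
Import numFieldNormedType.Exports.

Set Implicit Arguments.
Unset Strict Implicit.
Unset Printing Implicit Defensive.

Local Open Scope classical_set_scope.
Local Open Scope ring_scope.

(** * Primes between m and 2m *)

Section Bertrand.
Local Open Scope nat_scope.

Lemma prod_primes_dvd (a b m : nat) :
  (forall p, a <= p < b -> prime p -> p %| m) ->
  \prod_(a <= p < b | prime p) p %| m.
Proof.
elim: b => [|b IHb] Hm; first by rewrite big_geq.
have [ab|ab] := leqP a b; last by rewrite big_geq.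
have IH : \prod_(a <= p < b | prime p) p %| m.
  by apply: IHb => p /andP[ap pb]; apply: Hm; rewrite ap ltnW.
rewrite big_mkcond big_nat_recr //= -big_mkcond /=.
case: ifP => pb; last by rewrite muln1.
rewrite Gauss_dvd ?IH ?Hm ?ab ?leqnn //.
rewrite big_nat_cond; elim/big_rec: _ => [|p x /andP[/andP[_ ltpb] pp] cx].
  exact: coprime1n.
rewrite coprimeMl cx andbT prime_coprime // dvdn_prime2 //.
by rewrite neq_ltn ltpb.
Qed.

Definition primorial (n : nat) := \prod_(0 <= p < n.+1 | prime p) p.

(** The two middle coefficients of [(1 + 1) ^ m.*2.+1] are equal, so each is at most half of the
    whole sum. *)
Lemma bin_odd_le (m : nat) : 'C(m.*2.+1, m) <= 4 ^ m.
Proof.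
have h : 'C(m.*2.+1, m.+1) = 'C(m.*2.+1, m).
  rewrite -bin_sub; last lia.
  by congr 'C(_, _); lia.
have : 'C(m.*2.+1, m) + 'C(m.*2.+1, m.+1) <= 2 ^ m.*2.+1.
  rewrite -[2]/(1 + 1) expnDn.
  have hm : m < m.*2.+2 by lia.
  have hm1 : m.+1 < m.*2.+2 by lia.
  rewrite (bigD1 (Ordinal hm)) //= (bigD1 (Ordinal hm1)) /=; last first.
    by rewrite -val_eqE /= eqn_leq ltnn.
  by rewrite !exp1n !muln1 addnA leq_addr.
rewrite h expnS -mul2n expnM -[2 ^ 2]/4.
set x := 4 ^ m; set y := 'C(_, _); lia.
Qed.

(** Strong induction after Erdős. An even [n > 2] adds no prime; for [n = 2m + 1], the primes above
    [m + 1] divide the numerator but not the denominator of ['C(2m + 1, m)]. *)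
Lemma primorial_le (n : nat) : primorial n <= 4 ^ n.
Proof.
elim/ltn_ind: n => n IHn.
case: (ltnP n 3) => [|n3]; first by case: n {IHn} => [|[|[]]] //; rewrite /primorial !unlock.
have [on|en] := boolP (odd n); last first.
  case: n n3 en IHn => // n n3 en IHn.
  rewrite /primorial big_mkcond big_nat_recr //= -big_mkcond /=.
  have -> : prime n.+1 = false.
    by apply/negP => /even_prime [e|]; [lia | rewrite (negbTE en)].
  rewrite muln1; apply: leq_trans (IHn n _) _ => //.
  by rewrite leq_exp2l.
have [m nE] : exists m, n = m.*2.+1 by exists n./2; lia.
rewrite /primorial (@big_cat_nat _ _ _ m.+2) //=; last lia.
have h1 := IHn m.+1 ltac:(lia).
have h2 : \prod_(m.+2 <= p < n.+1 | prime p) p <= 4 ^ m.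
  apply: leq_trans (bin_odd_le m); apply: dvdn_leq; first by rewrite bin_gt0; lia.
  apply: prod_primes_dvd => p hp pp.
  have : p %| (m.*2.+1)`! by apply: dvdn_fact; lia.
  rewrite -(@bin_fact m.*2.+1 m); last lia.
  have h j : j < p -> ~~ (p %| j`!).
    elim: j => [|j IHj] hj; first by rewrite fact0 dvdn1; lia.
    rewrite factS Euclid_dvdM // negb_or IHj ?andbT; last lia.
    by apply/negP => /dvdn_leq; lia.
  rewrite !Euclid_dvdM // (negbTE (h _ _)); last lia.
  by rewrite (negbTE (h _ _)) ?orbF; last lia.
apply: leq_trans (leq_mul h1 h2) _.
by rewrite -expnD leq_exp2l // nE; lia.
Qed.

Lemma central_bin_ge (n : nat) : 4 ^ n <= n.*2.+1 * 'C(n.*2, n).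
Proof.
elim: n => [|n IHn]; first by rewrite bin0.
have h1 := mul_bin_diag n.*2.+2 n.
have h2 := mul_bin_down n.*2.+1 n.
rewrite /= in h1 h2.
have h2' : n.*2.+1 * 'C(n.*2, n) = n.+1 * 'C(n.*2.+1, n).
  by rewrite h2; congr (_ * _); lia.
rewrite doubleS expnS.
set C2 := 'C(n.*2.+2, n.+1) in h1 *; set C1 := 'C(n.*2.+1, n) in h1 h2' *.
have : C2 = 2 * C1.
  by apply/eqP; rewrite -(eqn_pmul2l (ltn0Sn n)) -h1; apply/eqP; lia.
move=> ->.
apply: leq_trans (_ : 4 * (n.+1 * C1) <= _); first by rewrite -h2' leq_mul2l IHn.
rewrite !mulnA leq_mul2r; apply/orP; right; lia.
Qed.

(** Legendre's formula: each power [q] of [p] contributes [n.*2 %/ q - 2 * (n %/ q)], which is 0 or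
    1 and hence the parity of [n.*2 %/ q]. *)
Lemma logn_central_bin (p n : nat) : prime p ->
  logn p 'C(n.*2, n) = \sum_(1 <= k < n.*2.+1) odd (n.*2 %/ p ^ k).
Proof.
move=> pp.
have h : logn p 'C(n.*2, n) + (logn p n`!).*2 = logn p (n.*2)`!.
  rewrite -(@bin_fact n.*2 n); last lia.
  have -> : n.*2 - n = n by lia.
  rewrite !lognM ?muln_gt0 ?fact_gt0 // ?bin_gt0; lia.
have h2 : logn p n`! = \sum_(1 <= k < n.*2.+1) n %/ p ^ k.
  rewrite logn_fact // [RHS](@big_cat_nat _ _ _ n.+1) //=; last lia.
  rewrite [X in _ = _ + X]big_nat [X in _ = _ + X]big1 ?addn0 // => k hk.
  apply: divn_small; apply: leq_ltn_trans (ltn_expl k (prime_gt1 pp)); lia.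
apply: (@addIn (logn p n`!).*2); rewrite h logn_fact // h2.
rewrite -[X in _ + X]muln2 big_distrl /= -big_split /=; apply: eq_big_nat => k _.
set q := p ^ k; have q0 : 0 < q by rewrite expn_gt0 prime_gt0.
have -> : n.*2 %/ q = ((n %/ q).*2 + (q <= (n %% q).*2)).
  rewrite {1}(divn_eq n q) doubleD -!muln2 mulnAC divnMDl //; congr (_ + _).
  have := ltn_pmod n q0; set r := n %% q => hr.
  case: leqP => hq; last by rewrite divn_small.
  have -> : r * 2 = 1 * q + (r * 2 - q) by lia.
  rewrite divnMDl // divn_small //; lia.
rewrite oddD odd_double /=; lia.
Qed.

(** Every term of the parity sum is at most 1, and it vanishes once [p ^ k] exceeds [n.*2]. *)
Lemma prime_power_central_bin (p n : nat) : prime p -> 0 < n ->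
  p ^ logn p 'C(n.*2, n) <= n.*2.
Proof.
move=> pp n0.
apply: (@leq_trans (p ^ trunc_log p n.*2)); last first.
  by apply: trunc_logP; [exact: prime_gt1 | lia].
rewrite leq_exp2l ?prime_gt1 // logn_central_bin //.
set l := trunc_log p n.*2.
have ll : l <= n.*2.
  have /= := trunc_logP (prime_gt1 pp) (_ : 0 < n.*2); rewrite -/l.
  move=> /(_ ltac:(lia)); have := ltn_expl l (prime_gt1 pp); lia.
rewrite (@big_cat_nat _ _ _ l.+1) //=.
rewrite [X in _ + X]big_nat [X in _ + X]big1 ?addn0; last first.
  move=> k hk; rewrite divn_small //.
  apply: leq_trans (trunc_log_ltn n.*2 (prime_gt1 pp)) _.
  by rewrite leq_exp2l; [case/andP: hk | exact: prime_gt1].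
apply: leq_trans (_ : \sum_(1 <= k < l.+1) 1 <= _).
  by apply: leq_sum => k _; case: odd.
by rewrite sum_nat_const_nat; lia.
Qed.

Lemma logn_central_bin_large (p n : nat) : prime p -> n.*2 < p ^ 2 ->
  logn p 'C(n.*2, n) = odd (n.*2 %/ p).
Proof.
move=> pp hp; rewrite logn_central_bin //.
case: n hp => [|n] hp; first by rewrite big_geq // div0n.
rewrite big_ltn; last lia.
rewrite expn1 big_nat big1 ?addn0 // => k hk.
rewrite divn_small //; apply: leq_trans hp _.
by rewrite leq_exp2l; [case/andP: hk | exact: prime_gt1].
Qed.

(** Primes up to [r] contribute at most [n.*2] each. Larger ones occur at most once, and those in
    [(2n/3, n]] not at all, because [n.*2 %/ p = 2] is even. The last hypothesis removes the primes
    above [n]. *)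
Lemma central_bin_le (n r : nat) : 2 < n -> r <= n.*2 -> n.*2 < r.+1 ^ 2 ->
  (forall p, prime p -> n < p <= n.*2 -> False) ->
  'C(n.*2, n) <= n.*2 ^ r.+1 * primorial (n.*2 %/ 3).
Proof.
move=> n2 hrn hr hp.
set C := 'C(n.*2, n).
have C0 : 0 < C by rewrite bin_gt0; lia.
have CE : C = \prod_(0 <= p < n.*2.+1 | prime p) p ^ logn p C.
  rewrite -{1}(partnT C0) (@widen_partn (n.*2 + C)) ?leq_addl //.
  rewrite big_mkcond [RHS]big_mkcond /=.
  rewrite (@big_cat_nat _ _ _ n.*2.+1) //=; last by rewrite ltnS leq_addr.
  rewrite [X in _ * X]big_nat [X in _ * X]big1 ?muln1.
    apply: eq_bigr => p _; case: ifP => // np.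
    by rewrite lognE np.
  move=> p /andP[hpn _].
  have [pp|np] := boolP (prime p); last by rewrite lognE (negbTE np).
  by rewrite logn_central_bin_large // ?divn_small //; nia.
pose A p := if p <= r then n.*2 else 1.
pose B p := if prime p && (p <= n.*2 %/ 3) then p else 1.
have hA : \prod_(0 <= p < n.*2.+1) A p = n.*2 ^ r.+1.
  rewrite (@big_cat_nat _ _ _ r.+1) //=.
  rewrite [X in _ * X]big_nat [X in _ * X]big1 ?muln1; last first.
    by move=> p /andP[hrp _]; rewrite /A leqNgt hrp.
  rewrite (eq_big_nat _ _ (F2 := fun=> n.*2)); last first.
    by move=> p /andP[_]; rewrite ltnS /A => ->.
  by rewrite prod_nat_const_nat subn0.
have hB : \prod_(0 <= p < n.*2.+1) B p = primorial (n.*2 %/ 3).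
  rewrite (@big_cat_nat _ _ _ (n.*2 %/ 3).+1) //=; last lia.
  rewrite [X in _ * X]big_nat [X in _ * X]big1 ?muln1; last first.
    by move=> p /andP[hrp _]; rewrite /B [p <= _]leqNgt hrp andbF.
  rewrite /primorial [RHS]big_mkcond /=; apply: eq_big_nat => p.
  by case/andP=> _; rewrite ltnS /B => ->; rewrite andbT.
rewrite -hA -hB -big_split /= CE big_mkcond /= big_nat [leqRHS]big_nat.
apply: leq_prod => p hpn.
have A0 : 0 < A p by rewrite /A; case: ifP => _; lia.
have B0 : 0 < B p.
  by rewrite /B; case: ifP => // /andP[pp _]; exact: prime_gt0.
case: ifP => pp; last by rewrite muln_gt0 A0.
have [hpr|hpr] := leqP p r.
  apply: leq_trans (leq_pmulr _ B0); rewrite /A hpr.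
  by apply: prime_power_central_bin => //; lia.
have hp2 : n.*2 < p ^ 2 by nia.
apply: leq_trans (leq_pmull _ A0).
rewrite logn_central_bin_large // /B pp /=.
case: ifP => h3; first by case: odd; rewrite ?expn1 // expn0 prime_gt0.
have hpn' : p <= n.
  by rewrite leqNgt; apply/negP => hnp; apply: (hp p pp); lia.
have -> : n.*2 %/ p = 2 by have := prime_gt0 pp; nia.
by rewrite expn0.
Qed.

(** With [l] the integer part of the binary logarithm of [r.+1], it suffices that
    [7 * (l + 1) <= 2 ^ l - 1]. This holds from [l = 6] on, whence the bound 63. *)
Lemma pow7_le_exp2 (r : nat) : 63 <= r -> r.+1 ^ 7 <= 2 ^ r.
Proof.
move=> hr; pose l := trunc_log 2 r.+1.
have hl : 2 ^ l <= r.+1 by apply: trunc_logP.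
have hl1 : r.+1 < 2 ^ l.+1 by exact: trunc_log_ltn.
have l6 : 6 <= l by apply: trunc_log_max.
have hx : forall k, 7 * (6 + k) + 8 <= 2 ^ (6 + k).
  move=> k; rewrite expnD -[2 ^ 6]/64.
  elim: k => [//|k]; rewrite [2 ^ k.+1]expnS; set y := 2 ^ k; lia.
have := hx (l - 6); rewrite subnKC // => h7.
apply: leq_trans (_ : (2 ^ l.+1) ^ 7 <= _).
  by rewrite leq_exp2r // ltnW.
rewrite -expnM leq_exp2l //; lia.
Qed.

Lemma bertrand_large : exists M : nat, forall n, M <= n ->
  exists p, [/\ prime p, n < p & p <= n.*2].
Proof.
(* Any threshold with [n.*2 >= 63 ^ 2] would force [r >= 63] below, where [r] is the integer square
   root of [n.*2]. *)
exists 5000 => n hn.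
have [/hasP[p]|/hasPn hnp] :=
    boolP (has (fun p => prime p) (iota n.+1 n)).
  by rewrite mem_iota => hp pp; exists p; split => //; lia.
exfalso.
have hno p : prime p -> n < p <= n.*2 -> False.
  move=> pp hp; have := hnp p; rewrite mem_iota pp => /(_ _)/negP; apply=> //.
  lia.
have [r hr1 hr2] : exists2 r, r ^ 2 <= n.*2 & n.*2 < r.+1 ^ 2.
  have ex : exists r, n.*2 < r.+1 ^ 2 by exists n; nia.
  case: (ex_minnP ex) => r hr hmin; exists r => //.
  case: r hr hmin => // r hr hmin; rewrite leqNgt; apply/negP => h.
  by have := hmin r h; rewrite ltnn.
have r63 : 63 <= r.
  rewrite leqNgt; apply/negP => h.
  have : r.+1 ^ 2 <= 63 ^ 2 by rewrite leq_exp2r.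
  lia.
have hrn : r <= n.*2 by nia.
have hC := central_bin_le (_ : 2 < n) hrn hr2 hno.
have {}hC := hC ltac:(lia).
have hge := central_bin_ge n.
have hpr := primorial_le (n.*2 %/ 3).
have h1 : 4 ^ n <= r.+1 ^ (r.*2 + 4) * 4 ^ (n.*2 %/ 3).
  apply: leq_trans hge _.
  apply: leq_trans (leq_mul hr2 (leq_trans hC (leq_mul (leqnn _) hpr))) _.
  rewrite mulnA leq_mul2r; apply/orP; right.
  apply: leq_trans (_ : r.+1 ^ 2 * (r.+1 ^ 2) ^ r.+1 <= _).
    by rewrite leq_mul2l leq_exp2r // (ltnW hr2) orbT.
  by rewrite -expnM -expnD leq_exp2l //; lia.
pose k := n - n.*2 %/ 3.
have h2 : 4 ^ k <= r.+1 ^ (r.*2 + 4).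
  rewrite -(leq_pmul2r (_ : 0 < 4 ^ (n.*2 %/ 3))) ?expn_gt0 //.
  by apply: leq_trans h1; rewrite -expnD leq_exp2l //; lia.
(* Cubing removes the loss of [4 ^ (2n/3)], since [n <= 3 * k]. With [r ^ 2 <= n.*2] this leads to
   [7 * r <= 6 * r + 12], against [r >= 63]. *)
have h3 : 4 ^ n <= (r.+1 ^ (r.*2 + 4)) ^ 3.
  apply: (@leq_trans ((4 ^ k) ^ 3)); last by rewrite leq_exp2r.
  by rewrite -expnM leq_exp2l //; lia.
have h4 : (2 ^ r) ^ r <= 4 ^ n.
  by rewrite -expnM -[4]/(2 ^ 2) -expnM leq_exp2l //; lia.
have h5 : (r.+1 ^ 7) ^ r <= (2 ^ r) ^ r.
  by rewrite leq_exp2r ?pow7_le_exp2 //; lia.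
have := leq_trans h5 (leq_trans h4 h3).
rewrite -!expnM leq_exp2l; lia.
Qed.
End Bertrand.

(** * The curve *)

Section Curve.
Variable K : fieldType.

(** If [a ^+ 2 + b ^+ 2 = -1], the two middle coordinates carry [(u - v, w + z)] to a vector with
    the opposite sum of squares. The sum of the four squares is then the hyperbolic form
    [4 (u v - w z)]. *)
Definition blk4 (a b u v w z : K) (i : nat) : K :=
  match i with
  | 0 => u + v
  | 1 => a * (u - v) - b * (w + z)
  | 2 => b * (u - v) + a * (w + z)
  | _ => w - z
  end.

Lemma blk4_sum (I : finType) (a b : K) (la u v w z : I -> K) (j : nat) :
  \sum_i la i * blk4 a b (u i) (v i) (w i) (z i) j =
  blk4 a b (\sum_i la i * u i) (\sum_i la i * v i)
           (\sum_i la i * w i) (\sum_i la i * z i) j.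
Proof.
case: j => [|[|[|j]]] /=; rewrite -?sumrN -?big_split /= ?mulr_sumr -?sumrN -?big_split /=;
  apply: eq_bigr => i _; ring.
Qed.

(** The middle coordinates are a linear image of [(u - v, w + z)] with determinant
    [a ^+ 2 + b ^+ 2 = -1]. Using three coordinates only lets this serve the three-dimensional core
    with [w = z] as well. *)
Lemma blk4_eq0 (a b u v w z : K) : a ^+ 2 + b ^+ 2 = -1 -> 2%:R != 0 :> K ->
  (forall j, (j < 3)%N -> blk4 a b u v w z j = 0) ->
  [/\ u = 0, v = 0 & w + z = 0].
Proof.
move=> hab h2 h.
have h0 : u + v = 0 := h 0%N isT.
have h1 : a * (u - v) - b * (w + z) = 0 := h 1%N isT.
have h3 : b * (u - v) + a * (w + z) = 0 := h 2%N isT.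
have huv : u - v = 0.
  transitivity (- (a * (a * (u - v) - b * (w + z)) + b * (b * (u - v) + a * (w + z)))).
    by transitivity (- (a ^+ 2 + b ^+ 2) * (u - v)); [rewrite hab; ring | ring].
  by rewrite h1 h3; ring.
have hwz : w + z = 0.
  transitivity (b * (a * (u - v) - b * (w + z)) - a * (b * (u - v) + a * (w + z))).
    by transitivity (- (a ^+ 2 + b ^+ 2) * (w + z)); [rewrite hab; ring | ring].
  by rewrite h1 h3; ring.
have hu : u = 0.
  apply: (mulfI h2); rewrite mulr0 -[RHS](addr0 0) -{1}h0 -huv; ring.
by split=> //; move: h0; rewrite hu add0r.
Qed.

Lemma blk4_sqr (a b u v w z : K) : a ^+ 2 + b ^+ 2 = -1 ->
  \sum_(j < 4) blk4 a b u v w z j ^+ 2 = 4%:R * (u * v - w * z).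
Proof.
move=> hab; rewrite !big_ord_recr big_ord0 /=.
transitivity ((u + v) ^+ 2 + (w - z) ^+ 2 + (a ^+ 2 + b ^+ 2) * ((u - v) ^+ 2 + (w + z) ^+ 2)).
  ring.
rewrite hab; ring.
Qed.

Lemma blk4_sqr3 (a b u v w : K) : a ^+ 2 + b ^+ 2 = -1 ->
  \sum_(j < 3) blk4 a b u v w w j ^+ 2 = 4%:R * (u * v - w ^+ 2).
Proof.
move=> hab; rewrite !big_ord_recr big_ord0 /=.
transitivity ((u + v) ^+ 2 + (a ^+ 2 + b ^+ 2) * ((u - v) ^+ 2 + (w + w) ^+ 2)).
  ring.
rewrite hab; ring.
Qed.

Definition blocks (a b : K) (U V W Z : nat -> K -> K) (n : nat) (g : nat -> K -> K)
  (j : nat) (t : K) : K :=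
  if (j < 4 * n)%N
  then blk4 a b (U (j %/ 4)%N t) (V (j %/ 4)%N t) (W (j %/ 4)%N t) (Z (j %/ 4)%N t) (j %% 4)
  else g (j - 4 * n)%N t.

Section Blocks.
Variables (a b : K) (U V W Z : nat -> K -> K) (n : nat) (g : nat -> K -> K).
Hypothesis hab : a ^+ 2 + b ^+ 2 = -1.

Lemma blocks_sqr (r : nat) (t : K) :
  (forall q, (q < n)%N -> U q t * V q t = W q t * Z q t) ->
  \sum_(j < 4 * n + r) blocks a b U V W Z n g j t ^+ 2 = \sum_(j < r) g j t ^+ 2.
Proof.
move=> h.
rewrite big_split_ord /= [X in X + _](_ : _ = 0) ?add0r; last first.
  transitivity (\sum_(j < 4 * n) blk4 a b (U (j %/ 4)%N t) (V (j %/ 4)%N t)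
     (W (j %/ 4)%N t) (Z (j %/ 4)%N t) (j %% 4) ^+ 2).
    by apply: eq_bigr => j _; rewrite /blocks ltn_ord.
  elim: n h => [|m IHm] h; first by rewrite muln0 big_ord0.
  rewrite mulnS addnC big_split_ord /= IHm ?add0r; last by move=> q hq; apply: h; lia.
  transitivity (4%:R * (U m t * V m t - W m t * Z m t)); last by rewrite h // subrr mulr0.
  rewrite -(blk4_sqr _ _ _ _ hab); apply: eq_bigr => j _; have j4 := ltn_ord j.
  have -> : ((4 * m + j) %/ 4 = m)%N by lia.
  by have -> : ((4 * m + j) %% 4 = j)%N by lia.
by apply: eq_bigr => j _; rewrite /blocks ltnNge leq_addr /= addKn.
Qed.

Lemma blocks_span (r : nat) (I : finType) (la t : I -> K) : 2%:R != 0 :> K ->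
  (forall j, (j < 4 * n + r)%N -> \sum_i la i * blocks a b U V W Z n g j (t i) = 0) ->
  (forall q, (q < n)%N ->
     [/\ \sum_i la i * U q (t i) = 0, \sum_i la i * V q (t i) = 0,
         \sum_i la i * W q (t i) = 0 & \sum_i la i * Z q (t i) = 0]) /\
  (forall j, (j < r)%N -> \sum_i la i * g j (t i) = 0).
Proof.
move=> h2 h; split=> [q hq|j hj]; last first.
  apply: etrans (h (4 * n + j)%N _); last by rewrite ltn_add2l.
  by apply: eq_bigr => i _; rewrite /blocks ltnNge leq_addr /= addKn.
have hk k : (k < 4)%N -> blk4 a b (\sum_i la i * U q (t i)) (\sum_i la i * V q (t i))
   (\sum_i la i * W q (t i)) (\sum_i la i * Z q (t i)) k = 0.
  move=> k4; rewrite -blk4_sum; apply: etrans (h (4 * q + k)%N _); last lia.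
  apply: eq_bigr => i _; rewrite /blocks.
  have -> : (4 * q + k < 4 * n)%N by lia.
  have -> : ((4 * q + k) %/ 4 = q)%N by lia.
  by have -> : ((4 * q + k) %% 4 = k)%N by lia.
have [-> -> hwz] := blk4_eq0 hab h2 (fun j hj => hk j (ltnW hj)).
have /= hwz' := hk 3%N isT.
move: hwz hwz'; set w0 := \sum_i _; set z0 := \sum_i _ => hwz hwz'.
split=> //; apply: (mulfI h2); rewrite mulr0.
  by transitivity ((w0 + z0) + (w0 - z0)); [ring | rewrite hwz hwz' addr0].
by transitivity ((w0 + z0) - (w0 - z0)); [ring | rewrite hwz hwz' subr0].
Qed.

End Blocks.

(* For m <= e, f m lies in the span of 1 and the c j as functions on K \ {0},
   phrased dually: a functional \sum_i la i * f (t i) killing the latter kills f m. *)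
Definition spans (d : nat) (c f : nat -> K -> K) (e : nat) : Prop :=
  forall (I : finType) (la t : I -> K), (forall i, t i != 0) ->
    (forall j, (j < d)%N -> \sum_i la i * c j (t i) = 0) ->
    \sum_i la i = 0 ->
  forall m, (m <= e)%N -> \sum_i la i * f m (t i) = 0.

(* The first clause rules out al * \prod_i t i = (-1) ^+ d * ga for nonzero
   squares t i; it holds either because ga = 0 or because ga / al is a nonsquare. *)
Definition curve_spec (d : nat) (c : nat -> K -> K) (k : nat) (al be ga : K) : Prop :=
  [/\ forall x, x != 0 -> al * x ^+ 2 != (-1) ^+ d * ga,
      forall t, t != 0 ->
        \sum_(j < d) c j t ^+ 2 = al * (t ^+ d.+1 / t ^+ k) + be + ga / t ^+ k.+1 &
      spans d c (fun m t => t ^+ m / t ^+ k) d].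

(** Block [q] takes the exponents [2q + 1], [d - 2q] and [2q + 2], [d - 2q - 1]. Both pairs sum to
    [d + 1], so the block is isotropic. The blocks use up [1..2n] and [2n + r + 1..d], and the core
    [g] must supply the [r] exponents in the middle. *)
Lemma poly_curve (a b : K) (n r : nat) (g : nat -> K -> K) (al : K) :
  a ^+ 2 + b ^+ 2 = -1 -> 2%:R != 0 :> K -> (0 < r)%N -> al != 0 ->
  (forall t, \sum_(j < r) g j t ^+ 2 = al * t ^+ (4 * n + r).+1) ->
  (forall (I : finType) (la t : I -> K),
     (forall j, (j < r)%N -> \sum_i la i * g j (t i) = 0) ->
     forall m, (2 * n < m <= 2 * n + r)%N -> \sum_i la i * t i ^+ m = 0) ->
  exists c, curve_spec (4 * n + r) c 0 al 0 0.
Proof.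
move=> hab h2 r0 al0 hg hs; set d := (4 * n + r)%N in hg *.
pose U q (t : K) := t ^+ (2 * q).+1; pose V q (t : K) := t ^+ (d - 2 * q).
pose W q (t : K) := t ^+ (2 * q).+2; pose Z q (t : K) := t ^+ (d - 2 * q).-1.
exists (blocks a b U V W Z n g); split.
- by move=> x x0; rewrite mulr0 mulf_neq0 // expf_neq0.
- move=> t t0; rewrite blocks_sqr // => [|q qn]; first by rewrite hg expr0 divr1 addr0 mul0r addr0.
  by rewrite /U /V /W /Z -!exprD; congr (_ ^+ _); rewrite /d; lia.
move=> I la t t0 hc h0 m hm.
have [hb /hs{}hs] := blocks_span hab h2 hc.
under eq_bigr do rewrite expr0 divr1.
have [->|m0] := posnP m.
  by apply: etrans h0; apply: eq_bigr => i _; rewrite expr0 mulr1.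
have [m1|m1] := leqP m (2 * n).
  have [] := hb ((m.-1) %/ 2)%N ltac:(lia).
  have [em|om] := boolP (odd m).
    by move=> h1 _ _ _; apply: etrans h1; apply: eq_bigr => i _; congr (_ * _ ^+ _); lia.
  by move=> _ _ h1 _; apply: etrans h1; apply: eq_bigr => i _; congr (_ * _ ^+ _); lia.
have [m2|m2] := leqP m (2 * n + r); first by apply: hs; rewrite m1.
have [] := hb ((d - m) %/ 2)%N ltac:(lia).
have [em|om] := boolP (odd (d - m)).
  by move=> _ _ _ h1; apply: etrans h1; apply: eq_bigr => i _; congr (_ * _ ^+ _); lia.
by move=> _ h1 _ _; apply: etrans h1; apply: eq_bigr => i _; congr (_ * _ ^+ _); lia.
Qed.

Lemma sum_mulCA (I : finType) (x : K) (la f : I -> K) :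
  \sum_i la i * (x * f i) = x * \sum_i la i * f i.
Proof. by rewrite mulr_sumr; apply: eq_bigr => i _; rewrite mulrCA. Qed.

(* In the next lemmas the core left over by the 4-blocks, which contribute 0 to
   the sum of squares, supplies the coefficient al of t ^+ d.+1. *)
Lemma curve_1mod4 (a b : K) (n : nat) :
  a ^+ 2 + b ^+ 2 = -1 -> 2%:R != 0 :> K ->
  exists c, curve_spec (4 * n + 1) c 0 1 0 0.
Proof.
move=> hab h2.
apply: (@poly_curve a b n 1 (fun _ t => t ^+ (2 * n).+1)) => //.
- exact: oner_neq0.
- by move=> t; rewrite big_ord1 mul1r -exprM; congr (_ ^+ _); lia.
move=> I la t h m hm; apply: etrans (h 0%N _) => //.
by apply: eq_bigr => i _; congr (_ * _ ^+ _); lia.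
Qed.

Lemma curve_3mod4 (a b : K) (n : nat) :
  a ^+ 2 + b ^+ 2 = -1 -> 2%:R != 0 :> K -> 3%:R != 0 :> K ->
  exists c, curve_spec (4 * n + 3) c 0 (- 12%:R) 0 0.
Proof.
move=> hab h2 h3.
(* The factor 2 keeps the core from being isotropic: the leading coefficient is [4 (1 - 4) = -12],
   nonzero as 2 and 3 are. *)
pose w (t : K) := 2%:R * t ^+ (2 * n).+2.
apply: (@poly_curve a b n 3 (fun j t =>
  blk4 a b (t ^+ (2 * n).+1) (t ^+ (2 * n).+3) (w t) (w t) j)) => //.
- rewrite oppr_eq0 (_ : 12%:R = 2%:R * 2%:R * 3%:R); last by ring.
  by rewrite !mulf_neq0.
- move=> t; rewrite blk4_sqr3 // /w -exprD [(_ * _) ^+ 2]exprMn -[_ ^+ _ ^+ 2]exprM.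
  have -> : ((2 * n).+1 + (2 * n).+3 = (4 * n + 3).+1)%N by lia.
  have -> : ((2 * n).+2 * 2 = (4 * n + 3).+1)%N by lia.
  ring.
move=> I la t h m hm.
have [//|j|hu hv hw] := @blk4_eq0 a b (\sum_i la i * t i ^+ (2 * n).+1)
  (\sum_i la i * t i ^+ (2 * n).+3) (\sum_i la i * w (t i)) (\sum_i la i * w (t i)) hab.
  by move=> hj; rewrite -blk4_sum h.
have hw' : \sum_i la i * t i ^+ (2 * n).+2 = 0.
  apply: (mulfI h2); apply: (mulfI h2); rewrite !mulr0; apply: etrans hw; rewrite sum_mulCA; ring.
have : m \in [:: (2 * n).+1; (2 * n).+2; (2 * n).+3] by rewrite !inE; lia.
by rewrite !inE => /or3P[] /eqP ->.
Qed.

Lemma curve_0mod4 (a b : K) (n : nat) :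
  a ^+ 2 + b ^+ 2 = -1 -> 2%:R != 0 :> K ->
  exists c, curve_spec (4 * n + 4) c 0 (- 4%:R) 0 0.
Proof.
move=> hab h2.
(* Again the factor 2 destroys isotropy, with leading coefficient [4 (1 - 2) = -4]. *)
pose z (t : K) := 2%:R * t ^+ (2 * n).+3.
apply: (@poly_curve a b n 4 (fun j t =>
  blk4 a b (t ^+ (2 * n).+1) (t ^+ (2 * n).+4) (t ^+ (2 * n).+2) (z t) j)) => //.
- rewrite oppr_eq0 (_ : 4%:R = 2%:R * 2%:R); last by ring.
  by rewrite !mulf_neq0.
- move=> t; rewrite blk4_sqr // /z [_ * (2%:R * _)]mulrCA -!exprD.
  have -> : ((2 * n).+1 + (2 * n).+4 = (4 * n + 4).+1)%N by lia.
  have -> : ((2 * n).+2 + (2 * n).+3 = (4 * n + 4).+1)%N by lia.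
  ring.
move=> I la t h m hm.
set u0 := \sum_i la i * t i ^+ (2 * n).+1.
set v0 := \sum_i la i * t i ^+ (2 * n).+4.
set w0 := \sum_i la i * t i ^+ (2 * n).+2.
set z0 := \sum_i la i * z (t i).
have hk j : (j < 4)%N -> blk4 a b u0 v0 w0 z0 j = 0.
  by move=> hj; rewrite -blk4_sum h.
have [hu hv hwz] := blk4_eq0 hab h2 (fun j hj => hk j (ltnW hj)).
have /= hwz' := hk 3%N isT.
have hw : w0 = 0.
  apply: (mulfI h2); rewrite mulr0; apply: etrans (_ : (w0 + z0) + (w0 - z0) = 0); first by ring.
  by rewrite hwz hwz' addr0.
have hz : \sum_i la i * t i ^+ (2 * n).+3 = 0.
  by apply: (mulfI h2); rewrite mulr0 -sum_mulCA -/z0 -[LHS]add0r -{1}hw.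
have : m \in [:: (2 * n).+1; (2 * n).+2; (2 * n).+3; (2 * n).+4].
  by rewrite !inE; lia.
by rewrite !inE => /or4P[] /eqP ->.
Qed.

(* Here the exponents are -k..k without 0, with k = 2n+1; all pairs (e, -e) except
   e = n+1 go to the isotropic blocks. *)
Lemma curve_2mod4 (a b r s : K) (n : nat) :
  a ^+ 2 + b ^+ 2 = -1 -> 2%:R != 0 :> K ->
  (forall x, x ^+ 2 != r ^+ 2 + s ^+ 2) ->
  exists c, curve_spec (4 * n + 2) c (2 * n).+1 1 (2%:R * r) (r ^+ 2 + s ^+ 2).
Proof.
move=> hab h2 hns; set d := (4 * n + 2)%N; set k := (2 * n).+1.
pose U q (t : K) := t ^+ q.+1; pose V q (t : K) := t^-1 ^+ q.+1.
pose W q (t : K) := t ^+ (k - q); pose Z q (t : K) := t^-1 ^+ (k - q).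
(* The squares of this core sum to [t^(2n+2) + 2 r + (r^2 + s^2) t^(-2n-2)], whose last coefficient
   is the required nonsquare [ga]. *)
pose g j (t : K) := if j is 0%N then t ^+ n.+1 + r * t^-1 ^+ n.+1 else s * t^-1 ^+ n.+1.
have s0 : s != 0.
  by apply/eqP => s0; have := hns r; rewrite s0 expr0n addr0 eqxx.
exists (blocks a b U V W Z n g); split.
- move=> x _; rewrite mul1r -signr_odd (_ : odd d = false) ?expr0 ?mul1r //.
  by rewrite /d; lia.
- move=> t t0; rewrite blocks_sqr // => [|q qn]; last first.
    by rewrite /U /V /W /Z -!exprMn divff // !expr1n.
  have hk : t ^+ d.+1 / t ^+ k = (t ^+ n.+1) ^+ 2.
    rewrite (_ : d.+1 = (n.+1 * 2 + k)%N); last by rewrite /d /k; lia.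
    by rewrite exprD mulfK ?expf_neq0 // exprM.
  have hk2 : (t ^+ k.+1)^-1 = (t^-1 ^+ n.+1) ^+ 2.
    by rewrite -exprVn -exprM; congr (_ ^+ _); rewrite /k; lia.
  have hk3 : t ^+ n.+1 * t^-1 ^+ n.+1 = 1 by rewrite -exprMn divff // expr1n.
  rewrite hk hk2 !big_ord_recr big_ord0 /=; move: hk3.
  move: (t ^+ n.+1) (t^-1 ^+ n.+1) => x y xy.
  by transitivity (x ^+ 2 + 2%:R * r * (x * y) + (r ^+ 2 + s ^+ 2) * y ^+ 2); [ring | rewrite xy; ring].
move=> I la t t0 hc h0 m hm.
have [hb hs] := blocks_span hab h2 hc.
have hneg : \sum_i la i * (t i)^-1 ^+ n.+1 = 0.
  by apply: (mulfI s0); rewrite mulr0 -sum_mulCA; exact: (hs 1%N).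
have hpos : \sum_i la i * (t i) ^+ n.+1 = 0.
  have := hs 0%N isT; rewrite /g /=.
  under eq_bigr do rewrite mulrDr.
  by rewrite big_split /= sum_mulCA hneg mulr0 addr0.
have [mk|mk|mk] := ltngtP m k; last 1 first.
- apply: etrans h0; apply: eq_bigr => i _.
  by rewrite mk divff ?mulr1 // expf_neq0.
- have [e [e1 e2 ->]] : exists e, [/\ (0 < e)%N, (e <= k)%N & m = (k - e)%N].
    by exists (k - m)%N; split; lia.
  have hE : \sum_i la i * (t i)^-1 ^+ e = 0.
    have [en|en|->//] := ltngtP e n.+1.
      have [_ h _ _] := hb e.-1 ltac:(lia).
      by apply: etrans h; apply: eq_bigr => i _; congr (_ * _ ^+ _); lia.
    have [_ _ _ h] := hb (k - e)%N ltac:(rewrite /k; lia).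
    by apply: etrans h; apply: eq_bigr => i _; congr (_ * _ ^+ _); lia.
  apply: etrans hE; apply: eq_bigr => i _; congr (_ * _).
  rewrite -[in X in _ / X](subnK e2) exprD invfM mulrA divff ?mul1r ?exprVn //.
  by rewrite expf_neq0.
have [e [e1 e2 ->]] : exists e, [/\ (0 < e)%N, (e <= k)%N & m = (e + k)%N].
  by exists (m - k)%N; split; rewrite /k /d in hm mk *; lia.
have hE : \sum_i la i * (t i) ^+ e = 0.
  have [en|en|->//] := ltngtP e n.+1.
    have [h _ _ _] := hb e.-1 ltac:(lia).
    by apply: etrans h; apply: eq_bigr => i _; congr (_ * _ ^+ _); lia.
  have [_ _ h _] := hb (k - e)%N ltac:(rewrite /k; lia).
  by apply: etrans h; apply: eq_bigr => i _; congr (_ * _ ^+ _); lia.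
apply: etrans hE; apply: eq_bigr => i _; congr (_ * _).
by rewrite exprD mulfK // expf_neq0.
Qed.

Lemma exists_curve (a b r s : K) (d : nat) :
  a ^+ 2 + b ^+ 2 = -1 -> 2%:R != 0 :> K -> 3%:R != 0 :> K ->
  (forall x, x ^+ 2 != r ^+ 2 + s ^+ 2) -> (0 < d)%N ->
  exists c k al be ga, curve_spec d c k al be ga.
Proof.
move=> hab h2 h3 hns d0.
have dE := divn_eq d 4; have := ltn_pmod d (isT : 0 < 4)%N.
set q := (d %/ 4)%N in dE *; set e := (d %% 4)%N in dE *.
case: e dE => [|[|[|[|//]]]] dE _.
(* One block of four is reserved for the core, hence [q.-1]; here [q > 0] because [d > 0]. *)
- have [c hc] := curve_0mod4 q.-1 hab h2.
  by exists c, 0%N, (- 4%:R), 0, 0; rewrite (_ : d = 4 * q.-1 + 4)%N //; lia.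
- have [c hc] := curve_1mod4 q hab h2.
  by exists c, 0%N, 1, 0, 0; rewrite (_ : d = 4 * q + 1)%N //; lia.
- have [c hc] := curve_2mod4 q hab h2 hns.
  by exists c, (2 * q).+1, 1, (2%:R * r), (r ^+ 2 + s ^+ 2);
    rewrite (_ : d = 4 * q + 2)%N //; lia.
have [c hc] := curve_3mod4 q hab h2 h3.
by exists c, 0%N, (- 12%:R), 0, 0; rewrite (_ : d = 4 * q + 3)%N //; lia.
Qed.

(** * Planes and spheres meeting the curve *)

Section GeneralPosition.
Variables (d : nat) (c : nat -> K -> K) (k : nat) (al be ga : K).
Hypothesis hc : curve_spec d c k al be ga.

(** The functional [la] kills [P / t^k] for every [P] of degree at most [d]; taking [P] to vanish at
    all parameters except [t i] isolates [la i]. Allowing [N < d.+1] also yields, with [N = 2], the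
    injectivity of the curve. *)
Lemma curve_plane (N : nat) (t la : 'I_N -> K) : (N <= d.+1)%N ->
  injective t -> (forall i, t i != 0) -> \sum_i la i = 0 ->
  (forall j, (j < d)%N -> \sum_i la i * c j (t i) = 0) -> forall i, la i = 0.
Proof.
case: hc => _ _ hs hN tinj t0 h0 hj i.
have {}hs := hs _ la t t0 hj h0.
pose P := \prod_(j <- enum [pred j | j != i]) ('X - (t j)%:P).
have sP : (size P <= d.+1)%N.
  rewrite size_prod_XsubC -cardE; have := cardC1 i; rewrite card_ord /= => ->.
  by case: N hN i {t la tinj t0 h0 hj hs P} => [|N] hN [].
have hP : \sum_j la j * (P.[t j] / t j ^+ k) = 0.
  under eq_bigr do rewrite (horner_coef_wide _ sP) mulr_suml mulr_sumr.
  rewrite exchange_big big1 //= => m _.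
  under eq_bigr do rewrite -mulrA.
  by rewrite sum_mulCA hs ?mulr0 // -ltnS.
have Pj j : j != i -> P.[t j] = 0.
  move=> ji; apply/rootP; rewrite /P -(big_map t xpredT (fun x => 'X - x%:P)).
  by rewrite root_prod_XsubC map_f // mem_enum.
have Pi : P.[t i] != 0.
  rewrite -/(root P (t i)) /P -(big_map t xpredT (fun x => 'X - x%:P)).
  by rewrite root_prod_XsubC mem_map // mem_enum inE eqxx.
move: hP; rewrite (bigD1 i) //= big1 ?addr0; last first.
  by move=> j ji; rewrite Pj // mul0r mulr0.
move/eqP; rewrite !mulf_eq0 (negbTE Pi) invr_eq0 expf_eq0 (negbTE (t0 i)) andbF !orbF.
by move/eqP.
Qed.

(** The functional is tested on [P / t^(k+1)], where [P] is a linear factor times the product of the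
    [X - t j] with [j != i]. If the linear factor vanished at [t i], then
    [al * \prod_j t j = (-1) ^+ d * ga]. The first clause of [curve_spec] excludes this, a product
    of nonzero squares being a nonzero square. *)
Lemma curve_sphere (t la : 'I_d.+2 -> K) :
  injective t -> (forall i, exists2 x, x != 0 & t i = x ^+ 2) -> \sum_i la i = 0 ->
  (forall j, (j < d)%N -> \sum_i la i * c j (t i) = 0) ->
  \sum_i la i * (\sum_(j < d) c j (t i) ^+ 2) = 0 -> forall i, la i = 0.
Proof.
case: hc => hns hq hs tinj tsq h0 hj hsq i.
have t0 j : t j != 0 by have [x x0 ->] := tsq j; rewrite expf_neq0.
have {}hs := hs _ la t t0 hj h0.
pose g := \prod_(j <- enum [pred j | j != i]) ('X - (t j)%:P).
have sg : size g = d.+2.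
  by rewrite size_prod_XsubC -cardE; have := cardC1 i; rewrite card_ord /= => ->.
have g0E : g.[0] = (-1) ^+ d.+1 * \prod_(j | j != i) t j.
  rewrite /g horner_prod big_enum /=.
  under eq_bigr do rewrite hornerXsubC sub0r.
  rewrite prodrN; congr (_ ^+ _ * _).
  by have := cardC1 i; rewrite card_ord.
have g0 : g.[0] != 0.
  rewrite g0E mulf_neq0 ?signr_eq0 //.
  by apply/prodf_neq0 => j _.
(* B is chosen so that P has constant term ga and leading term al X^(d+2): then
   P / X^(k+1) lies in the span of 1, the c j and |c|^2. *)
pose B := - (ga / g.[0]); pose P := (al *: 'X - B%:P) * g.
have sP : (size P <= d.+3)%N.
  apply: leq_trans (size_polyMleq _ _) _; rewrite sg.
  have : (size (al *: 'X - B%:P)%R <= 2)%N.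
    rewrite (leq_trans (size_polyD _ _)) // geq_max size_polyN.
    by rewrite (leq_trans (size_scale_leq _ _)) ?size_polyX // (leq_trans (size_polyC_leq1 _)).
  lia.
have P0 : P`_0 = ga.
  rewrite -horner_coef0 hornerM (_ : (al *: 'X - B%:P).[0] = - B).
    by rewrite /B opprK divfK.
  by rewrite hornerD hornerN hornerC hornerZ hornerX mulr0 sub0r.
have PN : P`_d.+2 = al.
  rewrite /P mulrBl coefB mul_polyC coefZ -scalerAl coefZ coefXM /=.
  rewrite [X in _ - _ * X]nth_default ?sg // mulr0 subr0.
  have : g \is monic by exact: monic_prod_XsubC.
  by rewrite monicE lead_coefE sg => /eqP ->; rewrite mulr1.
have hP : \sum_j la j * (P.[t j] / t j ^+ k.+1) = 0.
  have E j : la j * (P.[t j] / t j ^+ k.+1) =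
     la j * (al * (t j ^+ d.+1 / t j ^+ k) + be + ga / t j ^+ k.+1) - be * la j +
     \sum_(m < d.+1) P`_m.+1 * (la j * (t j ^+ m / t j ^+ k)).
    rewrite (horner_coef_wide _ sP) big_ord_recl big_ord_recr /= P0 PN expr0 mulr1.
    under [X in _ = _ + X]eq_bigr do rewrite mulrCA.
    rewrite -mulr_sumr.
    have -> : \sum_(m < d.+1) P`_m.+1 * (t j ^+ m / t j ^+ k) =
              (\sum_(m < d.+1) P`_(bump 0 m) * t j ^+ (bump 0 m)) / t j ^+ k.+1.
      rewrite mulr_suml; apply: eq_bigr => m _.
      rewrite -mulrA; congr (_ * _); rewrite !exprS; field.
      by rewrite t0 expf_neq0.
    move: (\sum_(m < _) _) => S; rewrite /bump /= add1n !exprS; field.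
    by rewrite t0 expf_neq0.
  under eq_bigr do rewrite E.
  rewrite big_split /= sumrB -mulr_sumr h0 mulr0 subr0.
  rewrite [X in X + _](_ : _ = 0) ?add0r; last first.
    apply: etrans hsq; apply: eq_bigr => j _; by rewrite hq.
  rewrite exchange_big big1 //= => m _.
  by rewrite -mulr_sumr hs ?mulr0 // -ltnS.
have Pj j : j != i -> P.[t j] = 0.
  move=> ji; rewrite /P hornerM; apply/eqP; rewrite mulf_eq0; apply/orP; right.
  rewrite -/(root g (t j)) /g -(big_map t xpredT (fun x => 'X - x%:P)).
  by rewrite root_prod_XsubC map_f // mem_enum.
have Pi : P.[t i] != 0.
  rewrite /P hornerM mulf_neq0 //; last first.
    rewrite -/(root g (t i)) /g -(big_map t xpredT (fun x => 'X - x%:P)).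
    by rewrite root_prod_XsubC mem_map // mem_enum inE eqxx.
  rewrite hornerD hornerN hornerC hornerZ hornerX subr_eq0; apply/eqP => hB.
  have [x x0 hx] : exists2 x, x != 0 & \prod_j t j = x ^+ 2.
    elim/big_rec: _ => [|j y _ [x x0 ->]]; first by exists 1; rewrite ?oner_neq0 ?expr1n.
    by have [z z0 ->] := tsq j; exists (z * x); rewrite ?mulf_neq0 ?exprMn.
  have /eqP := hns x x0; apply; rewrite -hx (bigD1 i) //= mulrA hB.
  have -> : \prod_(j | j != i) t j = (-1) ^+ d.+1 * g.[0].
    by rewrite g0E mulrA -exprD -signr_odd oddD addbb expr0 mul1r.
  by rewrite /B mulrCA mulNr divfK // exprS mulN1r mulrNN.
move: hP; rewrite (bigD1 i) //= big1 ?addr0; last first.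
  by move=> j ji; rewrite Pj // mul0r mulr0.
move/eqP; rewrite !mulf_eq0 (negbTE Pi) invr_eq0 expf_eq0 (negbTE (t0 i)) andbF !orbF.
by move/eqP.
Qed.
End GeneralPosition.
End Curve.

(** * Squares and sums of two squares modulo an odd prime *)

Section SumsOfSquares.
Variable p : nat.
Hypothesis pp : prime p.
Hypothesis p2 : (2 < p)%N.

Lemma natrFp_eq0 (n : nat) : (n%:R == 0 :> 'F_p) = (p %| n)%N.
Proof. by rewrite -(dvdn_pcharf (pchar_Fp pp)). Qed.

(** If squaring were onto the finite field it would be injective, but [1] and [-1] differ and have
    the same square. *)
Lemma exists_nonsquare : exists y : 'F_p, forall x, x ^+ 2 != y.
Proof.
have [/existsP[y /forallP hy]|] := boolP [exists y : 'F_p, [forall x, x ^+ 2 != y]].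
  by exists y.
rewrite negb_exists => /forallP h.
have hs (y : 'F_p) : {x | x ^+ 2 == y}.
  by apply/sigW; have := h y; rewrite negb_forall => /existsP[x]; rewrite negbK; exists x.
have fK : cancel (fun y => sval (hs y)) (fun x : 'F_p => x ^+ 2).
  by move=> y /=; case: (hs y) => x /= /eqP.
have /can_inj/(_ 1 (- 1)) := canF_sym fK.
rewrite sqrrN => /(_ erefl)/eqP; rewrite -subr_eq0 opprK -[1 + 1]/(2%:R) natrFp_eq0.
by move/dvdn_leq => /(_ isT); lia.
Qed.



(** The unit group is cyclic and nonsquares are odd powers of a generator, so a product of two is an
    even power. *)
Lemma nonsquare_mul (F : finFieldType) (x y : F) :
  (forall z, z ^+ 2 != x) -> (forall z, z ^+ 2 != y) -> exists z, z ^+ 2 = x * y.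
Proof.
move=> hx hy.
have x0 : x != 0 by have := hx 0; rewrite expr0n eq_sym.
have y0 : y != 0 by have := hy 0; rewrite expr0n eq_sym.
have /cyclicP[g hg] := field_unit_group_cyclic [set: {unit F}]%G.
have hpow (z : F) : z != 0 -> exists n, z = val g ^+ n.
  rewrite -unitfE => uz.
  have : FinRing.unit F uz \in <[g]>%g by rewrite -hg inE.
  by case/cycleP => n /(congr1 val) /= ->; exists n; rewrite FinRing.val_unitX.
have hodd z : (forall w, w ^+ 2 != z) -> z != 0 -> exists n, z = val g ^+ (n.*2.+1).
  move=> hz z0; have [n hn] := hpow z z0; exists n./2.
  have [on|en] := boolP (odd n).
    by rewrite hn -[in LHS](odd_double_half n) on.
  have /eqP[] := hz (val g ^+ n./2).
  by rewrite -exprM hn muln2 even_halfK.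
have [n ->] := hodd x hx x0; have [m ->] := hodd y hy y0.
exists (val g ^+ (n + m).+1); rewrite -exprM -exprD; congr (_ ^+ _); lia.
Qed.

(** Otherwise adding [1 ^+ 2] repeatedly, starting from 0, would show every residue to be a
    square. *)
Lemma exists_sum_sqr_nonsquare : exists r s : 'F_p, forall x, x ^+ 2 != r ^+ 2 + s ^+ 2.
Proof.
have [/existsP[r /existsP[s /forallP h]]|] :=
    boolP [exists r : 'F_p, exists s : 'F_p, [forall x, x ^+ 2 != r ^+ 2 + s ^+ 2]].
  by exists r, s.
rewrite negb_exists => /forallP h.
have {}h (r s : 'F_p) : exists x, x ^+ 2 = r ^+ 2 + s ^+ 2.
  have := h r; rewrite negb_exists => /forallP/(_ s).
  by rewrite negb_forall => /existsP[x]; rewrite negbK => /eqP; exists x.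
have hn (n : nat) : exists x : 'F_p, x ^+ 2 = n%:R.
  elim: n => [|n [x hx]]; first by exists 0; rewrite expr0n.
  by have [y hy] := h x 1; exists y; rewrite hy hx expr1n natr1.
have [y hy] := exists_nonsquare.
by have [x hx] := hn y; have /eqP[] := hy x; rewrite hx natr_Zp.
Qed.

(** If [-1] is a nonsquare and [g = r ^+ 2 + s ^+ 2] is one too, then [- g = z ^+ 2] for some [z],
    and scaling [r] and [s] by [z / g] turns [g] into [-1]. *)
Lemma exists_sum_sqr_eqN1 : exists a b : 'F_p, a ^+ 2 + b ^+ 2 = -1.
Proof.
have [r [s h]] := exists_sum_sqr_nonsquare.
have [/existsP[x /eqP hx]|] := boolP [exists x : 'F_p, x ^+ 2 == -1].
  by exists x, 0; rewrite hx expr0n addr0.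
rewrite negb_exists => /forallP h1.
have [z hz] := nonsquare_mul h h1.
have g0 : r ^+ 2 + s ^+ 2 != 0 by have := h 0; rewrite expr0n eq_sym.
move: hz g0; set g := _ + _ => hz g0.
exists (r * z / g), (s * z / g).
transitivity ((r ^+ 2 + s ^+ 2) * z ^+ 2 / g ^+ 2); first by rewrite !exprMn exprVn; ring.
rewrite -/g hz; field; exact: g0.
Qed.

Lemma natr_sqr_inj (i j : nat) : (i < p./2)%N -> (j < p./2)%N ->
  (i.+1%:R : 'F_p) ^+ 2 = j.+1%:R ^+ 2 -> i = j.
Proof.
move=> hi hj /eqP; rewrite eqf_sqr => /orP[]; last first.
  rewrite -subr_eq0 opprK -natrD natrFp_eq0 => /dvdn_leq -/(_ isT); lia.
wlog ij : i j hi hj / (i <= j)%N.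
  move=> H; have [ij|ji] := leqP i j; first exact: H.
  by rewrite eq_sym => e; rewrite (H j i) // ltnW.
rewrite eq_sym -subr_eq0 -natrB // natrFp_eq0 subSS => h.
have [|] := posnP (j - i); first lia.
by move=> h0; have := dvdn_leq h0 h; lia.
Qed.

Lemma natr_Fp_neq0 (i : nat) : (0 < i < p)%N -> (i%:R : 'F_p) != 0.
Proof.
by move=> hi; rewrite natrFp_eq0; apply/negP => /dvdn_leq; lia.
Qed.

End SumsOfSquares.

(* Affine independence of any d + 1 points of C, and of any d + 2 points of C
   once they are lifted to the paraboloid x |-> (x, |x|^2). *)
Definition gen_pos (K : finFieldType) (d : nat) (C : {set 'rV[K]_d}) : Prop :=
  (forall (x : 'I_d.+1 -> 'rV[K]_d) (la : 'I_d.+1 -> K),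
     injective x -> (forall i, x i \in C) ->
     \sum_i la i = 0 -> \sum_i la i *: x i = 0 -> forall i, la i = 0) /\
  (forall (x : 'I_d.+2 -> 'rV[K]_d) (la : 'I_d.+2 -> K),
     injective x -> (forall i, x i \in C) ->
     \sum_i la i = 0 -> \sum_i la i *: x i = 0 ->
     \sum_i la i * (\sum_j x i 0 j ^+ 2) = 0 -> forall i, la i = 0).

Lemma exists_gen_pos (p d : nat) : prime p -> (3 < p)%N -> (0 < d)%N ->
  exists2 C : {set 'rV['F_p]_d}, #|C| = p./2 & gen_pos C.
Proof.
move=> pp p3 d0; have p2 : (2 < p)%N by exact: ltnW.
have [a [b hab]] := exists_sum_sqr_eqN1 pp p2.
have [r [s hns]] := exists_sum_sqr_nonsquare pp p2.
have h2 : 2%:R != 0 :> 'F_p by apply: natr_Fp_neq0; lia.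
have h3 : 3%:R != 0 :> 'F_p by apply: natr_Fp_neq0; lia.
have [c [k [al [be [ga hc]]]]] := exists_curve hab h2 h3 hns d0.
pose tt (i : 'I_p./2) : 'F_p := (i.+1)%:R ^+ 2.
have tt_inj : injective tt.
  by move=> i j /(natr_sqr_inj pp p2 (ltn_ord i) (ltn_ord j)) /val_inj.
have tt0 i : tt i != 0.
  by rewrite expf_neq0 // natr_Fp_neq0 //; have := ltn_ord i; lia.
pose phi i : 'rV['F_p]_d := \row_(j < d) c j (tt i).
have hcoord N (x : 'I_N -> 'rV['F_p]_d) (la : 'I_N -> 'F_p) (f : 'I_N -> 'I_p./2) :
    (forall i, x i = phi (f i)) -> \sum_i la i *: x i = 0 ->
    forall j, (j < d)%N -> \sum_i la i * c j (tt (f i)) = 0.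
  move=> hx h j jd; have /matrixP/(_ 0 (Ordinal jd)) := h.
  rewrite summxE mxE => h'; apply: etrans h'.
  by apply: eq_bigr => i _; rewrite hx !mxE.
have idx N (x : 'I_N -> 'rV['F_p]_d) : injective x ->
    (forall i, x i \in [set phi i | i : 'I_p./2]%SET) ->
    exists2 f : 'I_N -> 'I_p./2, injective f & forall i, x i = phi (f i).
  move=> xinj hx.
  have hf i : {j | x i == phi j}.
    by apply/sigW; have /imsetP[j _ ->] := hx i; exists j.
  have hE i : x i = phi (sval (hf i)) by case: (hf i) => j /= /eqP.
  exists (fun i => sval (hf i)) => // i j hij.
  by apply: xinj; rewrite !hE hij.
exists [set phi i | i : 'I_p./2]%SET.
  rewrite card_imset ?card_ord // => i j hij; apply: tt_inj; apply/eqP; apply/negPn/negP => ne.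
  (* Two parameters with the same image would satisfy the affine relation with coefficients [1] and
     [-1], which [curve_plane] forbids for [N = 2]. *)
  pose t (u : 'I_2) := if u == ord0 then tt i else tt j.
  pose la (u : 'I_2) : 'F_p := if u == ord0 then 1 else -1.
  have tinj : injective t.
    move=> u v; rewrite /t; case: eqP => [->|/eqP u0]; case: eqP => [->|/eqP v0] //.
    - by move/eqP; rewrite (negbTE ne).
    - by move/eqP; rewrite eq_sym (negbTE ne).
    - by move=> _; apply: val_inj; move: u v u0 v0 => [[|[|//]] ?] [[|[|//]] ?].
  suff /eqP : la ord0 = 0 by rewrite /la eqxx oner_eq0.
  apply: (curve_plane hc _ tinj) => //.
  - by move=> u; rewrite /t; case: ifP.
  - by rewrite big_ord_recl big_ord1 /= subrr.
  - move=> m md; rewrite big_ord_recl big_ord1 /= mul1r mulN1r /t /=.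
    by have /rowP/(_ (Ordinal md)) := hij; rewrite !mxE /= => ->; rewrite subrr.
split=> x la xinj hx h0 h1.
  have [f finj fE] := idx _ x xinj hx.
  by apply: (curve_plane hc (t := fun i => tt (f i))) => //;
    [move=> i j /tt_inj/finj | exact: (hcoord _ _ _ _ fE)].
have [f finj fE] := idx _ x xinj hx => hsq.
apply: (curve_sphere hc (t := fun i => tt (f i))) => //.
- by move=> i j /tt_inj/finj.
- move=> i; exists ((f i).+1%:R) => //.
  by rewrite natr_Fp_neq0 //; have := ltn_ord (f i); lia.
- exact: (hcoord _ _ _ _ fE).
apply: etrans hsq; apply: eq_bigr => i _; congr (_ * _).
by apply: eq_bigr => j _; rewrite fE mxE.
Qed.

(** * Integer determinants under reduction *)

Definition ocons (T : Type) (n : nat) (x : T) (f : 'I_n -> T) (j : 'I_n.+1) : T :=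
  oapp f x (unlift ord0 j).

Lemma ocons0 (T : Type) (n : nat) (x : T) (f : 'I_n -> T) : ocons x f ord0 = x.
Proof. by rewrite /ocons unlift_none. Qed.

Lemma oconsS (T : Type) (n : nat) (x : T) (f : 'I_n -> T) (j : 'I_n) :
  ocons x f (lift ord0 j) = f j.
Proof. by rewrite /ocons liftK. Qed.

(** A real kernel vector makes the integer determinant vanish, hence also its image in [K]. Passing
    from columns to rows turns an equation shared by real points into a linear relation between
    their reductions. *)
Lemma nat_matrix_singular (R : numFieldType) (K : fieldType) (n : nat)
    (G : 'I_n -> 'I_n -> nat) (u : 'I_n -> R) :
  (exists j, u j != 0) -> (forall i, \sum_j u j * (G i j)%:R = 0) ->
  exists2 la : 'I_n -> K, exists i, la i != 0 &
    forall j, \sum_i la i * (G i j)%:R = 0.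
Proof.
move=> [j0 uj0] hu; pose M : 'M[int]_n := \matrix_(i, j) (G i j)%:Z.
have M0 : \det M = 0.
  apply/eqP; rewrite -(intr_eq0 R) -det_map_mx -det_tr; apply/det0P.
  exists (\row_j u j).
    by apply/eqP => /rowP/(_ j0); rewrite !mxE => /eqP; rewrite (negbTE uj0).
  apply/rowP => i; rewrite !mxE -[RHS](hu i).
  by apply: eq_bigr => j _; rewrite !mxE.
have /det0P[v v0 hv] : \det (map_mx intr M : 'M[K]_n) == 0.
  by rewrite det_map_mx M0 rmorph0.
exists (fun i => v 0 i).
  by have /rV0Pn[i] := v0; exists i.
move=> j; have /rowP/(_ j) := hv; rewrite !mxE => h; apply: etrans h.
by apply: eq_bigr => i _; rewrite !mxE.
Qed.

(** * Lifting to the integer grid *)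

Section Lift.
Variables (R : realType) (p d n : nat).
Hypothesis pp : prime p.
(** A box of side at most [p] is used so that reduction modulo [p] is injective on it. *)
Let m := minn n p.

Definition embed_grid (x : 'rV['I_m]_d) : 'rV['I_n]_d :=
  map_mx (widen_ord (geq_minl n p)) x.

Definition reduce_grid (x : 'rV['I_m]_d) : 'rV['F_p]_d :=
  \row_j (x 0 j).+1%:R.

Definition lift_set (C : {set 'rV['F_p]_d}) (w : 'rV['F_p]_d) : {set 'rV['I_n]_d} :=
  (embed_grid @: [set x | reduce_grid x + w \in C])%SET.

Lemma embed_grid_inj : injective embed_grid.
Proof.
move=> x y /matrixP h; apply/matrixP => i j; have := h i j; rewrite !mxE.
by move/(congr1 val) => /= e; apply: val_inj.
Qed.

Lemma reduce_grid_inj : injective reduce_grid.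
Proof.
move=> x y /matrixP h; apply/matrixP => i j; have := h i j; rewrite !ord1 !mxE.
have := ltn_ord (x 0 j); have := ltn_ord (y 0 j).
move: (x 0 j) (y 0 j) => u v hv hu e; apply: val_inj => /=.
have up : (u < p)%N by rewrite (leq_trans hu) // geq_minr.
have vp : (v < p)%N by rewrite (leq_trans hv) // geq_minr.
move: e up vp {hu hv}; move: (u : nat) (v : nat) => {u v} u v.
wlog uv : u v / (u <= v)%N => [H e hu hv|e hu hv].
  have [uv|vu] := leqP u v; first exact: H.
  by rewrite (H v u) // ltnW.
move/eqP: e; rewrite eq_sym -subr_eq0 -natrB // natrFp_eq0 // subSS => pdvd.
have [|h0] := posnP (v - u); first lia.
by have := dvdn_leq h0 pdvd; lia.
Qed.

Lemma lift_family (C : {set 'rV['F_p]_d}) (w : 'rV['F_p]_d) (B : {set 'rV['I_n]_d}) (N : nat) :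
  B \subset lift_set C w -> #|B| = N ->
  exists y : 'I_N -> 'rV['I_m]_d,
    [/\ injective y, forall i, reduce_grid (y i) + w \in C &
        forall i, embed_grid (y i) \in B].
Proof.
move=> BA <-.
have hy (i : 'I_#|B|) : {y | (enum_val i == embed_grid y) && (reduce_grid y + w \in C)}.
  apply/sigW; have /imsetP[y] := fintype.subsetP BA _ (enum_valP i).
  by rewrite inE => hC ->; exists y; rewrite eqxx.
exists (fun i => sval (hy i)); split.
- move=> i j hij; apply: enum_val_inj.
  case: (hy i) (hy j) hij => /= x /andP[/eqP -> _] [/= z /andP[/eqP -> _]] ->.
  by [].
- by move=> i; case: (hy i) => /= x /andP[].
- by move=> i; case: (hy i) => /= x /andP[/eqP <- _]; exact: enum_valP.
Qed.

(** The plane gives the kernel vector [(- b, a)] of the matrix with rows [(1, y)]. The relation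
    obtained modulo [p] has coefficients summing to 0, so it survives translation by [w]. *)
Lemma lift_no_coplanar (C : {set 'rV['F_p]_d}) (w : 'rV['F_p]_d) :
  gen_pos C -> no_coplanar R d.+1 (lift_set C w).
Proof.
move=> [hC _] B BA Bd [a [b [a0 hab]]].
have [y [yinj yC yB]] := lift_family BA Bd.
pose G i := ocons 1%N (fun k : 'I_d => (y i 0 k).+1).
have [|i|la [i0 /negP la0] hla] :=
    @nat_matrix_singular R 'F_p d.+1 G (ocons (- b) (fun k => a 0 k)).
- have /rV0Pn[k hk] := a0; exists (lift ord0 k); by rewrite oconsS.
- have : hyperplane a b (grid_pt R (embed_grid (y i))).
    by apply: hab; exists (embed_grid (y i)) => //=; exact: yB.
  rewrite /hyperplane /= => h.
  rewrite big_ord_recl /G !ocons0 mulr1 -h addrC; apply/eqP; rewrite subr_eq0; apply/eqP.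
  by apply: eq_bigr => k _; rewrite !oconsS !mxE.
apply: la0; apply/eqP.
have h0 : \sum_i la i = 0.
  by apply: etrans (hla ord0); apply: eq_bigr => i _; rewrite /G ocons0 mulr1.
have hred : \sum_i la i *: reduce_grid (y i) = 0.
  apply/rowP => k; rewrite summxE mxE; apply: etrans (hla (lift ord0 k)).
  by apply: eq_bigr => i _; rewrite /G oconsS !mxE.
apply: (hC (fun i => reduce_grid (y i) + w)) => //.
  by move=> i j /addIr /reduce_grid_inj /yinj.
under eq_bigr do rewrite scalerDr.
by rewrite big_split /= hred -scaler_suml h0 scale0r addr0.
Qed.

(** Expanding [|y - c|^2 = r^2] gives the kernel vector [(|c|^2 - r^2, 1, -2 c)] of the matrix with
    rows [(1, |y|^2, y)]; its entry 1 makes it nonzero. *)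
Lemma lift_no_cospherical (C : {set 'rV['F_p]_d}) (w : 'rV['F_p]_d) :
  gen_pos C -> no_cospherical R d.+2 (lift_set C w).
Proof.
move=> [_ hC] B BA Bd [c [r [r0 hcr]]].
have [y [yinj yC yB]] := lift_family BA Bd.
pose G i := ocons 1%N (ocons (\sum_(k < d) (y i 0%R k).+1 ^ 2)%N (fun k : 'I_d => (y i 0 k).+1)).
have [|i|la [i0 /negP la0] hla] :=
    @nat_matrix_singular R 'F_p d.+2 G
      (ocons (\sum_(k < d) c 0 k ^+ 2 - r ^+ 2) (ocons 1 (fun k => - 2%:R * c 0 k))).
- by exists (lift ord0 ord0); rewrite oconsS ocons0 oner_neq0.
- have : esphere c r (grid_pt R (embed_grid (y i))).
    by apply: hcr; exists (embed_grid (y i)) => //=; exact: yB.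
  rewrite /esphere /= /eucl_dist => h.
  have {}h : \sum_(k < d) ((y i 0 k).+1%:R - c 0 k) ^+ 2 = r ^+ 2.
    rewrite -h sqr_sqrtr; last by apply: sumr_ge0 => k _; exact: sqr_ge0.
    by apply: eq_bigr => k _; rewrite !mxE.
  rewrite !big_ord_recl /G !oconsS !ocons0 mulr1 mul1r -h natr_sum -sumrB addrA -big_split -big_split /=.
  by rewrite big1 // => k _; rewrite !oconsS natrX; ring.
apply: la0; apply/eqP.
have h0 : \sum_i la i = 0.
  by apply: etrans (hla ord0); apply: eq_bigr => i _; rewrite /G ocons0 mulr1.
have hk k : \sum_i la i * reduce_grid (y i) 0 k = 0.
  apply: etrans (hla (lift ord0 (lift ord0 k))).
  by apply: eq_bigr => i _; rewrite /G !oconsS !mxE.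
have hsq : \sum_i la i * \sum_k reduce_grid (y i) 0 k ^+ 2 = 0.
  apply: etrans (hla (lift ord0 ord0)).
  apply: eq_bigr => i _; rewrite /G oconsS ocons0 natr_sum; congr (_ * _).
  by apply: eq_bigr => k _; rewrite !mxE natrX.
have hred : \sum_i la i *: reduce_grid (y i) = 0.
  apply/rowP => k; rewrite summxE mxE; apply: etrans (hk k).
  by apply: eq_bigr => i _; rewrite mxE.
apply: (hC (fun i => reduce_grid (y i) + w)) => //.
- by move=> i j /addIr /reduce_grid_inj /yinj.
- under eq_bigr do rewrite scalerDr.
  by rewrite big_split /= hred -scaler_suml h0 scale0r addr0.
(* Translation changes [|y|^2] by [2 w.y + |w|^2], an affine function of [y], which the relation
   kills. *)
have E i : la i * (\sum_k (reduce_grid (y i) + w) 0 k ^+ 2) =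
    la i * (\sum_k reduce_grid (y i) 0 k ^+ 2) +
    \sum_k (2%:R * w 0 k) * (la i * reduce_grid (y i) 0 k) + la i * \sum_k w 0 k ^+ 2.
  rewrite !mulr_sumr -!big_split /=; apply: eq_bigr => k _; rewrite [(_ + w) 0 k]mxE; ring.
under eq_bigr do rewrite E.
rewrite !big_split /= hsq add0r -mulr_suml h0 mul0r addr0 exchange_big big1 //= => k _.
by rewrite -mulr_sumr hk mulr0.
Qed.

(* Averaging over the translation vector w. *)
Lemma lift_card (C : {set 'rV['F_p]_d}) :
  exists w, (m ^ d * #|C| <= #|lift_set C w| * p ^ d)%N.
Proof.
(* Double counting: each of the [m ^ d] box points is lifted for exactly [#|C|] translations. *)
have hsum : (\sum_w #|lift_set C w| = m ^ d * #|C|)%N.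
  under eq_bigr do rewrite (card_imset _ embed_grid_inj) -sum1_card.
  under eq_bigr do rewrite big_mkcond.
  rewrite exchange_big /=.
  transitivity (\sum_(x : 'rV['I_m]_d) #|C|)%N; last first.
    by rewrite sum_nat_const card_mx card_ord mul1n.
  apply: eq_bigr => x _; rewrite -sum1_card -big_mkcond.
  rewrite [RHS](reindex_inj (addrI (reduce_grid x))) /=.
  by apply: eq_bigl => w; rewrite inE.
have cardV : #|{: 'rV['F_p]_d}| = (p ^ d)%N by rewrite card_mx card_Fp // mul1n.
have [/existsP[w hw]|] := boolP [exists w, (m ^ d * #|C| <= #|lift_set C w| * p ^ d)%N].
  by exists w.
rewrite negb_exists => /forallP h.
suff : (\sum_(w : 'rV['F_p]_d) #|lift_set C w| * p ^ d < \sum_(w : 'rV['F_p]_d) m ^ d * #|C|)%N.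
  by rewrite -big_distrl /= hsum sum_nat_const cardV mulnC ltnn.
have p0 : (0 < p ^ d)%N by rewrite expn_gt0 prime_gt0.
rewrite (bigD1 0) //= [ltnRHS](bigD1 0) //= -addSn.
apply: leq_add; first by rewrite ltnNge h.
by apply: leq_sum => w _; rewrite ltnW // ltnNge h.
Qed.

End Lift.

(** * Choice of the prime and the asymptotic bound *)

Lemma ex_pl_sph_ge (R : realType) (p d n : nat) : prime p -> (3 < p)%N -> (0 < d)%N ->
  (minn n p ^ d * p./2 <= ex_pl_sph R d n d.+1 d.+2 * p ^ d)%N.
Proof.
move=> pp p3 d0; have [C <- hC] := exists_gen_pos pp p3 d0.
have [w hw] := lift_card n pp C; apply: leq_trans hw _; rewrite leq_mul2r; apply/orP; right.
rewrite /ex_pl_sph; apply: leq_bigmax_cond.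
by apply/asboolP; split; [exact: lift_no_coplanar | exact: lift_no_cospherical].
Qed.

(** For [d >= 3] a prime in [(n/2, n]] gives about [n/4] points. For [d = 2] the prime lies in
    [(2n/3, 4n/3]]: if [p <= n] it gives about [n/3] points at least, and if [p > n] about
    [n^2 / (2p) >= 3n/8]. *)
Lemma ex_pl_sph_linear (R : realType) (d : nat) : (2 <= d)%N ->
  exists n0, forall n, (n0 <= n)%N -> (n <= d.+1 * (ex_pl_sph R d n d.+1 d.+2).+1)%N.
Proof.
move=> d2; have [M hM] := bertrand_large.
have small p n : prime p -> (3 < p)%N -> (p <= n)%N ->
    (p./2 <= ex_pl_sph R d n d.+1 d.+2)%N.
  move=> pp p3 pn; have := ex_pl_sph_ge R n pp p3 (ltnW d2).
  by rewrite (minn_idPr pn) mulnC leq_pmul2r // expn_gt0 prime_gt0.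
have [d3|d3] := leqP 3 d.
  exists ((M + 4).*2)%N => n hn.
  have [p [pp hp1 hp2]] := hM n./2 ltac:(lia).
  have := small p n pp ltac:(lia) ltac:(lia); set e := ex_pl_sph _ _ _ _ _ => he.
  apply: leq_trans (_ : 4 * e.+1 <= _)%N; first lia.
  by rewrite leq_mul2r ltnS d3 orbT.
have dE : d = 2%N by lia.
subst d.
exists (2 * M + 10)%N => n hn.
have [p [pp hp1 hp2]] := hM (2 * n %/ 3)%N ltac:(lia).
have [pn|np] := leqP p n.
  by have := small p n pp ltac:(lia) pn; set e := ex_pl_sph _ _ _ _ _; lia.
have := ex_pl_sph_ge R n pp (_ : 3 < p)%N (isT : 0 < 2)%N.
rewrite (minn_idPl (ltnW np)) => /(_ ltac:(lia)).
set e := ex_pl_sph _ _ _ _ _ => he.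
(* If [3 * e.+1 < n], then [3 * p <= 4 * n] leads to [9 n (p - 1) <= 8 (n - 3) p], that is
   [(p - 9) n + 24 p <= 0], impossible for [p >= 9]. *)
rewrite leqNgt; apply/negP => hlt.
have h1 : (n ^ 2 * p.-1 <= 2 * e * p ^ 2)%N.
  rewrite -mulnA; apply: leq_trans (_ : 2 * (n ^ 2 * p./2) <= _)%N; last by rewrite leq_mul2l he.
  rewrite mulnCA leq_mul2l; apply/orP; right; lia.
have h2 : (3 * (n ^ 2 * p.-1) <= 2 * (n - 3) * p ^ 2)%N.
  apply: leq_trans (_ : 3 * (2 * e * p ^ 2) <= _)%N; first by rewrite leq_mul2l h1.
  rewrite [(3 * _)%N]mulnA leq_mul2r; apply/orP; right; lia.
have h3 : (9 * (n * (n * p.-1)) <= 8 * (n * ((n - 3) * p)))%N.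
  apply: leq_trans (_ : 3 * (2 * (n - 3) * p ^ 2) <= _)%N; first by rewrite -mulnn in h2; lia.
  have hp : (3 * p <= 4 * n)%N by lia.
  have := leq_mul (leqnn (2 * (n - 3) * p)%N) hp; rewrite -mulnn; lia.
have {}h3 : (9 * (n * p.-1) <= 8 * ((n - 3) * p))%N.
  by rewrite -(@leq_pmul2l n) ?(mulnCA n); lia.
have h4 : (9 * n <= p * n)%N by rewrite leq_mul2r; lia.
move: h3; rewrite -subn1 mulnBr muln1 mulnBl; nia.
Qed.


Unset Implicit Arguments.
Set Strict Implicit.
Set Printing Implicit Defensive.

Theorem theorem3 (R : realType) (d : nat) (hd : (2 <= d)%N) :
  exists e : nat -> R,
    (e n / n%:R @[n --> \oo] --> (0 : R)) /\
    (forall n : nat,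
       n%:R / (d.+1)%:R - e n <= (ex_pl_sph R d n d.+1 d.+2)%:R).
Proof.
have [n0 hn0] := ex_pl_sph_linear R hd.
(* A constant error suffices: it absorbs the rounding by 1 when [n >= n0], and exceeds [n / (d + 1)]
   when [n < n0]. *)
exists (fun=> n0.+1%:R); split.
  (* The shift matches [harmonic], whose [n]-th term is the inverse of [n.+1]. *)
  rewrite -cvg_shiftS.
  have : (n0.+1%:R : R) * @harmonic R n @[n --> \oo] --> (n0.+1%:R : R) * 0.
    by apply: cvgM; [exact: cvg_cst | exact: cvg_harmonic].
  by rewrite mulr0.
move=> n; rewrite lerBlDr ler_pdivrMr ?ltr0n // -natrD -natrM ler_nat.
have [h|h] := leqP n0 n.
  apply: leq_trans (hn0 n h) _; rewrite mulnC leq_mul2r; apply/orP; right; lia.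
nia.
Qed.
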